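(* Let $A=\langle\langle a,b\rangle\rangle$ have dimension $\ge3$, where $a$ is a weakly primitive axis satisfying the fusion rules and $b=\alpha_ba+b_0+\sum_{(\mu,\nu)\in S}b_{\mu,\nu}$ is an axis; $S=S(a)$, $S^\circ=S^\circ(a)$. For every $(\mu,\nu)\in S^\circ$, putting $\varepsilon=\mu+\nu$ $(\ne0)$, the following four equations hold: $$(\mu-\nu)\Big(\frac{1-2\alpha_b}{\varepsilon}\Big)b_{\mu,\nu}^2=b_{\mu,\nu}^2b_0-b_0b_{\mu,\nu}^2;$$ $$b_{\mu',\nu'}b_{\mu,\nu}^2=b_{\mu,\nu}^2b_{\mu',\nu'}\quad\text{for all }(\mu',\nu')\in S;$$ $$b_{\mu,\nu}b_0^2-b_0^2b_{\mu,\nu}=(\mu-\nu)\frac{1-2\alpha_b+\alpha_b^2\varepsilon}{\varepsilon}\,b_{\mu,\nu};$$ $$b_0b_0^2-b_0^2b_0=(1-2\alpha_b)\sum_{(\mu',\nu')\in S^\circ}\frac{\mu'-\nu'}{\mu'+\nu'}\,b_{\mu',\nu'}^2.$$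
   Context: $\mathbb F$ is a field of characteristic $\ne 2$. Algebras are $\mathbb F$-algebras, not assumed associative, commutative or unital; $\langle\langle X\rangle\rangle$ is the subalgebra generated by $X$. For $y\in A$ put $L_y(z)=yz$, $R_y(z)=zy$; $A_\mu(L_y)$ and $A_\nu(R_y)$ denote eigenspaces. An axis of $A$ is an idempotent $a$ such that $A$ is the direct sum of the eigenspaces of $L_a$, $A$ is the direct sum of the eigenspaces of $R_a$, and $L_aR_a=R_aL_a$. Let $S_L(a),S_R(a)$ be the sets of eigenvalues of $L_a,R_a$; $A_{\mu,\nu}(a)=A_\mu(L_a)\cap A_\nu(R_a)$; $A_\mu(a)=A_{\mu,\mu}(a)$; $S=S(a)=(S_L(a)\times S_R(a))\setminus\{(0,0),(1,1)\}$; $S^\circ(a)=\{(\mu,\nu)\in S(a):A_{\mu,\nu}(a)\neq0\}$. So $A=A_1(a)\oplus A_0(a)\oplus\bigoplus_{(\mu,\nu)\in S}A_{\mu,\nu}(a)$, and each $y\in A$ is written accordingly as $y=y_1+y_0+\sum_{(\mu,\nu)\in S}y_{\mu,\nu}$. The axis $a$ is weakly primitive if $A_1(a)=\mathbb F a$; then $y_1=\alpha_ya$ with $\alpha_y\in\mathbb F$. The axis $a$ satisfies the fusion rules if: (a) $A_{\mu,\nu}(a)A_{\mu',\nu'}(a)=0$ for all $(\mu,\nu)\neq(\mu',\nu')$ in $S$; (b) $A_{\mu,\nu}(a)^2\subseteq A_0(a)+A_1(a)$ for $(\mu,\nu)\in S$; (c) $(A_0(a)+A_1(a))(A_0(a)+A_1(a))\subseteq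 A_0(a)+A_1(a)$; (d) $(A_1(a)+A_0(a))A_{\mu,\nu}(a)\subseteq A_{\mu,\nu}(a)$ and $A_{\mu,\nu}(a)(A_1(a)+A_0(a))\subseteq A_{\mu,\nu}(a)$ for $(\mu,\nu)\in S$.
   Formalization: The condition μ+ν≠0 for every (μ,ν) in S° is taken as a hypothesis, since it does not follow from the other assumptions (it can fail when α_b=1/2) and the four equations divide by these sums. *)

(* Defs.v *)
From HB Require Import structures.
From mathcomp Require Import all_boot all_algebra.
From mathcomp Require Import boolp classical_sets functions cardinality fsbigop.

Set Implicit Arguments.
Unset Strict Implicit.
Unset Printing Implicit Defensive.

Import GRing.Theory.

Local Open Scope ring_scope.
Local Open Scope classical_set_scope.

Section LinearAlgebra.
Variables (F : fieldType) (A : lmodType F).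
Implicit Types (V : set A) (f : A -> A).

Definition dim_ge (n : nat) : Prop :=
  exists v : 'I_n -> A, forall c : 'I_n -> F,
    \sum_(i < n) c i *: v i = 0 -> forall i, c i = 0.

Definition eigensp f (mu : F) : set A := [set z | f z = mu *: z].

Definition eigenvals f : set F := [set mu | exists2 z, z != 0 & f z = mu *: z].

(* [\sum_(i \in D) y i] is 0 by convention when infinitely many terms are
   nonzero, so every use on data that are not known to be finitely supported
   is accompanied by this condition. *)
Definition fin_supp (I : choiceType) (D : set I) (y : I -> A) : Prop :=
  finite_set (D `&` [set i | y i != 0]).

(* The last clause only makes the unique family [y] a well-defined function on
   the whole of [I]. *)
Definition is_direct_sum (I : choiceType) (D : set I) (V : I -> set A) : Prop :=
  forall x : A, exists! y : I -> A,
    [/\ forall i, D i -> V i (y i),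
        fin_supp D y,
        x = \sum_(i \in D) y i
      & forall i, ~ D i -> y i = 0].

Definition sumset V1 V2 : set A := [set x + y | x in V1 & y in V2].

End LinearAlgebra.

(* An algebra is an F-module A with a bilinear product [mul]; A may be infinite
   dimensional, and [mul] need not be associative, commutative or unital. *)
Section Axes.
Variables (F : fieldType) (A : lmodType F) (mul : {bilinear A -> A -> A}).
Implicit Types (a y : A) (X B : set A).

Definition is_subalg B : Prop :=
  [/\ B 0,
      forall x y, B x -> B y -> B (x + y),
      forall (c : F) x, B x -> B (c *: x)
    & forall x y, B x -> B y -> B (mul x y)].

Definition gen_subalg X : set A := smallest is_subalg X.

Definition Lmul y : A -> A := fun z => mul y z.
Definition Rmul y : A -> A := fun z => mul z y.

Definition SL a : set F := eigenvals (Lmul a).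
Definition SR a : set F := eigenvals (Rmul a).

Definition is_axis a : Prop :=
  [/\ mul a a = a,
      is_direct_sum (SL a) (eigensp (Lmul a)),
      is_direct_sum (SR a) (eigensp (Rmul a))
    & forall z, Lmul a (Rmul a z) = Rmul a (Lmul a z)].

Definition Apair a (p : F * F) : set A :=
  eigensp (Lmul a) p.1 `&` eigensp (Rmul a) p.2.

Definition Asingle a (mu : F) : set A := Apair a (mu, mu).

Definition Spair a : set (F * F) :=
  (SL a `*` SR a) `\` [set (0, 0); (1, 1)].

Definition Scirc a : set (F * F) :=
  [set p | Spair a p /\ exists2 x, Apair a p x & x != 0].

Definition weakly_primitive a : Prop :=
  Asingle a 1 = [set c *: a | c in [set: F]].

Definition A01 a : set A := sumset (Asingle a 0) (Asingle a 1).

Definition fusion_rules a : Prop :=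
  [/\ forall p q, Spair a p -> Spair a q -> p <> q ->
        forall x y, Apair a p x -> Apair a q y -> mul x y = 0,
      forall p, Spair a p ->
        forall x y, Apair a p x -> Apair a p y -> A01 a (mul x y),
      forall x y, A01 a x -> A01 a y -> A01 a (mul x y)
    & forall p, Spair a p -> forall x y, A01 a x -> Apair a p y ->
        Apair a p (mul x y) /\ Apair a p (mul y x)].

(* y = alpha a + y0 + \sum_(p in S) yS p is the decomposition of y along the
   eigenspaces of a; values of [yS] outside S are irrelevant. *)
Definition is_decomp a y (alpha : F) (y0 : A) (yS : F * F -> A) : Prop :=
  [/\ Asingle a 0 y0,
      forall p, Spair a p -> Apair a p (yS p),
      fin_supp (Spair a) yS
    & y = alpha *: a + y0 + \sum_(p \in Spair a) yS p].

End Axes.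

(* Main.v *)
Require Import Defs.
From mathcomp Require Import all_boot all_algebra.
From mathcomp Require Import boolp classical_sets functions cardinality fsbigop.
From mathcomp Require Import ring.
Import GRing.Theory.
Local Open Scope ring_scope.
Local Open Scope classical_set_scope.

(* Commuting of [L_b] and [R_b] means [b (z b) = (b z) b] for all [z].  The
   fusion rules make the components of a product explicit, so this identity and
   [b b = b] can be compared component by component along the eigenspaces of
   [a].  Write [c = alpha a + b_0].  Idempotency together with [z = a] gives
   [c b_p = lambda_p b_p] and [b_p c = rho_p b_p], where
   [rho_p - lambda_p = (mu - nu) (1 - 2 alpha) / eps], and
   [\sum_p (mu - nu) b_p^2 = 0].  Then [z = b_p] yields the first two equations
   and [z = b_0] the last two. *)

(** The index sets [Spair] and [Scirc] may be infinite. Sums over them are replaced by sums over one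
    finite list carrying the support, where bilinearity applies directly. *)
Lemma fsbig_seq_supp (V : nmodType) (I : choiceType) (D : set I) (r : seq I)
    (f : I -> V) :
  uniq r -> (forall i, i \in r -> D i) ->
  (forall i, D i -> i \notin r -> f i = 0) ->
  \sum_(i \in D) f i = \sum_(i <- r) f i.
Proof.
move=> ur rD f0; rewrite (fsbigE r) // big_seq_cond [RHS]big_seq_cond.
by apply: eq_bigl => i; rewrite andbT; case: (boolP (i \in r)) => //= /rD/mem_set.
Qed.

Lemma addr_eq_cross (V : zmodType) (u x y z : V) :
  u + x = y + z -> x - z = y - u.
Proof.
by move=> e; apply/eqP; rewrite subr_eq addrAC eq_sym subr_eq -e addrC.
Qed.

(** * Joint eigenspaces of [L_a] and [R_a], and their independence *)

Section JointEigenvectors.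
Variables (F : fieldType) (A : lmodType F) (mul : {bilinear A -> A -> A}).
Variable a : A.

Lemma ApairP (p : F * F) (x : A) :
  Apair mul a p x <-> mul a x = p.1 *: x /\ mul x a = p.2 *: x.
Proof. by []. Qed.

Lemma Apair0 (p : F * F) : Apair mul a p 0.
Proof. by apply/ApairP; rewrite linear0l linear0r !scaler0. Qed.

Lemma ApairD (p : F * F) (x y : A) :
  Apair mul a p x -> Apair mul a p y -> Apair mul a p (x + y).
Proof.
move=> /ApairP[xl xr] /ApairP[yl yr]; apply/ApairP.
by rewrite linearDl linearDr xl xr yl yr !scalerDr.
Qed.

Lemma ApairZ (p : F * F) (k : F) (x : A) :
  Apair mul a p x -> Apair mul a p (k *: x).
Proof.
move=> /ApairP[xl xr]; apply/ApairP.
by rewrite linearZl_LR linearZr_LR /= xl xr !scalerA ![k * _]mulrC.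
Qed.

(** Induction on the list: multiplying the zero sum by [a] on the left or on the right and
    subtracting a multiple of the sum removes the head [q]. The induction hypothesis kills
    [(p.1 - q.1) *: y p] and [(p.2 - q.2) *: y p], and one of these scalars is nonzero because [p]
    differs from [q]. *)
Lemma joint_eigenvectors_free (s : seq (F * F)) (y : F * F -> A) :
  uniq s -> (forall p, p \in s -> Apair mul a p (y p)) ->
  \sum_(p <- s) y p = 0 -> forall p, p \in s -> y p = 0.
Proof.
elim: s y => [//|q s IHs] y /= /andP[qs us] ye.
rewrite big_cons => sum0.
have ys p : p \in s -> Apair mul a p (y p).
  by move=> ps; apply: ye; rewrite inE ps orbT.
have /ApairP[qL qR] := ye q (mem_head q s).
(* Here [t] is a coordinate projection and [k] the same coordinate of [q]; the head is eliminated by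
   writing [y q] as minus the sum of the others. *)
have shift (t : F * F -> F) (k : F) :
    k *: y q + \sum_(p <- s) t p *: y p = 0 ->
    forall p, p \in s -> (t p - k) *: y p = 0.
  move=> h; apply: IHs => // [p ps|]; first exact/ApairZ/ys.
  under eq_bigr do rewrite scalerBl.
  rewrite sumrB -scaler_sumr.
  move: sum0 h => /eqP; rewrite addrC addr_eq0 => /eqP -> /eqP.
  by rewrite addrC addr_eq0 => /eqP ->; rewrite scalerN opprK addNr.
have hL := congr1 (mul a) sum0; have hR := congr1 (fun z => mul z a) sum0.
move: hL hR; rewrite /= linearDr linearDl linear_sumr linear_sumlz.
rewrite linear0r linear0l qL qR.
rewrite (eq_big_seq (fun p => p.1 *: y p)); last by move=> p /ys/ApairP[].
rewrite [X in _ -> _ + X = _ -> _](eq_big_seq (fun p => p.2 *: y p)); last first.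
  by move=> p /ys/ApairP[].
move=> /shift h1 /shift h2.
have y0 p : p \in s -> y p = 0.
  move=> ps; move: (h1 p ps) (h2 p ps) => /eqP + /eqP.
  rewrite !scaler_eq0 !subr_eq0 => /orP[/eqP e1|/eqP //] /orP[/eqP e2|/eqP //].
  by move: qs; rewrite (surjective_pairing q) -e1 -e2 -surjective_pairing ps.
move=> p; rewrite inE => /orP[/eqP ->|/y0 //].
by move: sum0; rewrite big_seq big1 ?addr0.
Qed.

(** * The subspace [A_0(a) + A_1(a)] *)

Lemma A01D (x y : A) : A01 mul a x -> A01 mul a y -> A01 mul a (x + y).
Proof.
move=> [x0 hx0 [x1 hx1 <-]] [y0 hy0 [y1 hy1 <-]].
by exists (x0 + y0); [exact: ApairD|exists (x1 + y1); [exact: ApairD|]];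
  rewrite addrACA.
Qed.

Lemma A01Z (k : F) (x : A) : A01 mul a x -> A01 mul a (k *: x).
Proof.
move=> [x0 hx0 [x1 hx1 <-]]; exists (k *: x0); first exact: ApairZ.
by exists (k *: x1); [exact: ApairZ|rewrite scalerDr].
Qed.

Lemma A01_0 : A01 mul a 0.
Proof.
by exists 0; [exact: Apair0|exists 0; [exact: Apair0|rewrite addr0]].
Qed.

Lemma A01_sum (s : seq (F * F)) (x : F * F -> A) :
  (forall p, p \in s -> A01 mul a (x p)) -> A01 mul a (\sum_(p <- s) x p).
Proof.
move=> hx; rewrite big_seq.
by apply: big_ind => //; [exact: A01_0|exact: A01D].
Qed.

Lemma A01_comm (x : A) : A01 mul a x -> mul a x = mul x a.
Proof.
move=> [x0 /ApairP[l0 r0] [x1 /ApairP[l1 r1] <-]].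
by rewrite linearDl linearDr l0 l1 r0 r1.
Qed.

(** * Uniqueness of components along a finite list of pairs *)

Section Components.
Variable s : seq (F * F).
Hypotheses (us : uniq s) (sS : forall p, p \in s -> Spair mul a p).

Lemma components_eq0 (x : A) (y : F * F -> A) :
  A01 mul a x -> (forall p, p \in s -> Apair mul a p (y p)) ->
  x + \sum_(p <- s) y p = 0 -> x = 0 /\ forall p, p \in s -> y p = 0.
Proof.
move=> [x0 hx0 [x1 hx1 <-]] hy sum0.
have ns0 : (0, 0) \notin s by apply/negP => /sS[_] []; left.
have ns1 : (1, 1) \notin s by apply/negP => /sS[_] []; right.
have n01 : ((0, 0) == (1, 1) :> F * F) = false.
  by rewrite xpair_eqE eq_sym oner_eq0.
(* The two parts of [x] become components at the extra indices [(0, 0)] and [(1, 1)]. [Spair]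
   excludes both, so the enlarged list is still free of repetitions. *)
pose y' p := if p == (0, 0) then x0 else if p == (1, 1) then x1 else y p.
have y's p : p \in s -> y' p = y p.
  move=> ps; rewrite /y'; case: eqP => [e|_]; first by rewrite -e ps in ns0.
  by case: eqP => // e; rewrite -e ps in ns1.
have y'0 : y' (0, 0) = x0 by rewrite /y' eqxx.
have y'1 : y' (1, 1) = x1 by rewrite /y' eq_sym n01 eqxx.
have h p : p \in [:: (0, 0), (1, 1) & s] -> y' p = 0.
  apply: joint_eigenvectors_free => [|q|].
  - by rewrite /= inE n01 ns0 ns1.
  - rewrite !inE => /or3P[/eqP ->|/eqP ->|qs]; rewrite ?y'0 ?y'1 ?y's //.
    exact: hy.
  - by rewrite !big_cons y'0 y'1 addrA (eq_big_seq _ y's).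
have := h (0, 0); have := h (1, 1); rewrite !inE !eqxx orbT y'0 y'1.
move=> /(_ isT) -> /(_ isT) ->; split=> [|p ps]; first by rewrite addr0.
by rewrite -y's // h // !inE ps !orbT.
Qed.

Lemma components_inj (x x' : A) (y y' : F * F -> A) :
  A01 mul a x -> A01 mul a x' ->
  (forall p, p \in s -> Apair mul a p (y p)) ->
  (forall p, p \in s -> Apair mul a p (y' p)) ->
  x + \sum_(p <- s) y p = x' + \sum_(p <- s) y' p ->
  x = x' /\ forall p, p \in s -> y p = y' p.
Proof.
move=> hx hx' hy hy' /eqP; rewrite -subr_eq0 opprD addrACA -sumrB => /eqP e.
have [||e0 eS] := components_eq0 _ _ _ _ e.
- by rewrite -scaleN1r; apply/A01D/A01Z.
- by move=> p ps; rewrite -scaleN1r; apply/ApairD/ApairZ; [exact: hy|exact: hy'].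
- by split=> [|p /eS eSp]; apply/eqP; rewrite -subr_eq0 ?e0 ?eSp.
Qed.

(** * Components of a product under the fusion rules *)

Hypothesis hfus : fusion_rules mul a.

Lemma A01M (x x' : A) : A01 mul a x -> A01 mul a x' -> A01 mul a (mul x x').
Proof. by case: hfus => _ _ + _; apply. Qed.

Lemma Apair_sqr (p : F * F) (y y' : A) : p \in s ->
  Apair mul a p y -> Apair mul a p y' -> A01 mul a (mul y y').
Proof. by move=> /sS Sp; case: hfus => _ + _ _; apply. Qed.

Lemma A01_Apair (p : F * F) (x y : A) : p \in s ->
  A01 mul a x -> Apair mul a p y -> Apair mul a p (mul x y).
Proof. by move=> /sS Sp hx hy; case: hfus => _ _ _ /(_ p Sp x y hx hy)[]. Qed.

Lemma Apair_A01 (p : F * F) (x y : A) : p \in s ->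
  A01 mul a x -> Apair mul a p y -> Apair mul a p (mul y x).
Proof. by move=> /sS Sp hx hy; case: hfus => _ _ _ /(_ p Sp x y hx hy)[]. Qed.

Lemma A01_mul_component (x x' : A) (y y' : F * F -> A) :
  A01 mul a x -> A01 mul a x' ->
  (forall p, p \in s -> Apair mul a p (y p)) ->
  (forall p, p \in s -> Apair mul a p (y' p)) ->
  A01 mul a (mul x x' + \sum_(p <- s) mul (y p) (y' p)).
Proof.
move=> hx hx' hy hy'; apply: A01D; first exact: A01M.
by apply: A01_sum => p ps; apply: Apair_sqr (hy p ps) (hy' p ps).
Qed.

Lemma Apair_mul_component (p : F * F) (x x' y y' : A) : p \in s ->
  A01 mul a x -> A01 mul a x' -> Apair mul a p y -> Apair mul a p y' ->
  Apair mul a p (mul x y' + mul y x').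
Proof.
by move=> ps hx hx' hy hy'; apply: ApairD; [exact: A01_Apair|exact: Apair_A01].
Qed.

(** Products of components at different pairs vanish, so only the diagonal survives. The right side
    is bracketed so that, for [x] and [x'] in [A01], its first summand is again in [A01] and its
    [p]-th term in the eigenspace of [p], as [components_inj] requires. *)
Lemma mul_components (x x' : A) (y y' : F * F -> A) :
  (forall p, p \in s -> Apair mul a p (y p)) ->
  (forall p, p \in s -> Apair mul a p (y' p)) ->
  mul (x + \sum_(p <- s) y p) (x' + \sum_(p <- s) y' p) =
  (mul x x' + \sum_(p <- s) mul (y p) (y' p)) +
  \sum_(p <- s) (mul x (y' p) + mul (y p) x').
Proof.
move=> hy hy'; rewrite linearDl !linearDr linear_sumr !linear_sumlz big_split /=.
rewrite [X in _ + X = _]addrC addrACA; congr (_ + _ + _).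
apply: eq_big_seq => p ps.
rewrite linear_sumr (bigD1_seq p) //= big_seq_cond big1 ?addr0 // => q.
move=> /andP[qs qp]; case: hfus => + _ _ _.
move=> /(_ p q (sS p ps) (sS q qs)); apply; last exact: hy'.
  by apply/eqP; rewrite eq_sym.
exact: hy.
Qed.

(** * Idempotency of [b] and commutation of [L_b] with [R_b], by components *)

Variables (b c : A) (bS : F * F -> A).
Hypotheses (hc : A01 mul a c) (hbS : forall p, p \in s -> Apair mul a p (bS p)).
Hypothesis bE : b = c + \sum_(p <- s) bS p.

Lemma idempotent_components : mul b b = b ->
  forall p, p \in s -> mul c (bS p) + mul (bS p) c = bS p.
Proof.
rewrite {1 2 3}bE mul_components // => /components_inj[] //.
- exact: A01_mul_component.
- by move=> p ps; apply: Apair_mul_component => //; exact: hbS.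
Qed.

Lemma flexible_components (x : A) (y : F * F -> A) :
  A01 mul a x -> (forall p, p \in s -> Apair mul a p (y p)) ->
  (forall z, mul b (mul z b) = mul (mul b z) b) ->
  mul c (mul x c + \sum_(p <- s) mul (y p) (bS p)) +
    \sum_(p <- s) mul (bS p) (mul x (bS p) + mul (y p) c) =
  mul (mul c x + \sum_(p <- s) mul (bS p) (y p)) c +
    \sum_(p <- s) mul (mul c (y p) + mul (bS p) x) (bS p)
  /\ forall p, p \in s ->
  mul c (mul x (bS p) + mul (y p) c) +
    mul (bS p) (mul x c + \sum_(q <- s) mul (y q) (bS q)) =
  mul (mul c x + \sum_(q <- s) mul (bS q) (y q)) (bS p) +
    mul (mul c (y p) + mul (bS p) x) c.
Proof.
move=> hx hy /(_ (x + \sum_(p <- s) y p)).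
(* The components of [z b] and [b z] lie in the right subspaces, so after a second multiplication by
   [b] the two sides can again be compared component by component. *)
have zb0 := A01_mul_component _ _ _ _ hx hc hy hbS.
have bz0 := A01_mul_component _ _ _ _ hc hx hbS hy.
have zbS p (ps : p \in s) : Apair mul a p (mul x (bS p) + mul (y p) c).
  by apply: Apair_mul_component => //; [exact: hy|exact: hbS].
have bzS p (ps : p \in s) : Apair mul a p (mul c (y p) + mul (bS p) x).
  by apply: Apair_mul_component => //; [exact: hbS|exact: hy].
rewrite bE !mul_components // => /components_inj; apply.
- exact: A01_mul_component.
- exact: A01_mul_component.
- by move=> p ps; apply: Apair_mul_component => //; [exact: hbS|exact: zbS].
- by move=> p ps; apply: Apair_mul_component => //; [exact: bzS|exact: hbS].
Qed.

Lemma flexible_components_A01 (x : A) :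
  A01 mul a x -> (forall z, mul b (mul z b) = mul (mul b z) b) ->
  mul c (mul x c) + \sum_(p <- s) mul (bS p) (mul x (bS p)) =
    mul (mul c x) c + \sum_(p <- s) mul (mul (bS p) x) (bS p)
  /\ forall p, p \in s ->
  mul c (mul x (bS p)) + mul (bS p) (mul x c) =
    mul (mul c x) (bS p) + mul (mul (bS p) x) c.
Proof.
move=> hx hflex.
have y0 p : p \in s -> Apair mul a p 0 by move=> _; exact: Apair0.
have [/= + /= eS] := flexible_components x (fun=> 0) hx y0 hflex.
under eq_bigr do rewrite linear0l.
under [X in _ + X = _]eq_bigr do rewrite linear0l addr0.
under [X in mul (_ + X) _]eq_bigr do rewrite linear0r.
under [X in _ = _ + X]eq_bigr do rewrite linear0r add0r.
rewrite big1 // !addr0 => ->; split=> // p /eS.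
under eq_bigr do rewrite linear0l.
under [X in mul (_ + X) _]eq_bigr do rewrite linear0r.
by rewrite !big1 // linear0l linear0r !addr0 add0r.
Qed.

Lemma flexible_components_Apair (q : F * F) (v : A) :
  q \in s -> Apair mul a q v ->
  (forall z, mul b (mul z b) = mul (mul b z) b) ->
  [/\ mul c (mul v (bS q)) + mul (bS q) (mul v c) =
        mul (mul (bS q) v) c + mul (mul c v) (bS q),
      mul c (mul v c) + mul (bS q) (mul v (bS q)) =
        mul (mul (bS q) v) (bS q) + mul (mul c v) c
    & forall p, p \in s -> p != q ->
      mul (bS p) (mul v (bS q)) = mul (mul (bS q) v) (bS p)].
Proof.
move=> qs hv hflex.
(* The family concentrated at [q]; [sumq] then reduces each sum over [s] to its term at [q]. *)
pose y p := if p == q then v else 0.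
have hy p : p \in s -> Apair mul a p (y p).
  by rewrite /y; case: eqP => [->|_ _] //; exact: Apair0.
have sumq (G : F * F -> A -> A) : (forall p, G p 0 = 0) ->
    \sum_(p <- s) G p (y p) = G q v.
  move=> G0; rewrite (bigD1_seq q) //= big1 ?addr0 /y ?eqxx // => p.
  by move=> /negPf ->.
have := flexible_components 0 y A01_0 hy hflex.
rewrite (sumq (fun p x => mul x (bS p))); last by move=> p; rewrite linear0l.
rewrite (sumq (fun p x => mul (bS p) x)); last by move=> p; rewrite linear0r.
rewrite (sumq (fun p x => mul (bS p) (mul 0 (bS p) + mul x c))); last first.
  by move=> p; rewrite !linear0l addr0 linear0r.
rewrite (sumq (fun p x => mul (mul c x + mul (bS p) 0) (bS p))); last first.
  by move=> p; rewrite !linear0r addr0 linear0l.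
rewrite !linear0l !linear0r !addr0 !add0r => -[e0 eS]; split=> // [|p ps pq].
- by have := eS q qs; rewrite /y eqxx linear0l linear0r add0r addr0.
- have := eS p ps; rewrite /y (negPf pq).
  by rewrite !(linear0l, linear0r) !addr0 linear0r linear0l add0r addr0.
Qed.

(** * Evaluation at [a], at [b_p] and at [b_0] *)

Section Flexible.
Variables (alpha : F) (b0 : A).
Hypotheses (haa : mul a a = a) (hb0 : Asingle mul a 0 b0).
Hypothesis cE : c = alpha *: a + b0.
Hypothesis heps : forall p, p \in s -> p.1 + p.2 != 0.
Hypotheses (bb : mul b b = b).
Hypothesis bflex : forall z, mul b (mul z b) = mul (mul b z) b.

(** With [p = (mu, nu)], [lam] and [rho] solve the system [lam + rho = 1], from idempotency, and
    [mu lam + alpha nu = alpha mu + nu rho], from [z = a]. *)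
Let lam (p : F * F) := (p.2 + alpha * (p.1 - p.2)) / (p.1 + p.2).
Let rho (p : F * F) := (p.1 - alpha * (p.1 - p.2)) / (p.1 + p.2).

Lemma A01_axis : A01 mul a a.
Proof.
exists 0; first exact: Apair0.
by exists a; [apply/ApairP; rewrite haa scale1r|rewrite add0r].
Qed.

Lemma A01_b0 : A01 mul a b0.
Proof. by exists b0 => //; exists 0; [exact: Apair0|rewrite addr0]. Qed.

Lemma axis_b0 : mul a b0 = 0 /\ mul b0 a = 0.
Proof. by case/ApairP: hb0; rewrite !scale0r. Qed.

Lemma axis_c : mul a c = alpha *: a /\ mul c a = alpha *: a.
Proof.
have [l r] := axis_b0.
by rewrite cE linearDl linearDr linearZl_LR linearZr_LR /= haa l r addr0.
Qed.

Lemma c_b0 : mul c b0 = mul b0 b0 /\ mul b0 c = mul b0 b0.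
Proof.
have [l r] := axis_b0.
by rewrite cE linearDl linearDr linearZl_LR linearZr_LR /= l r !scaler0 !add0r.
Qed.

(** Since [a] commutes with [A01], the summand [alpha *: a] of [c] drops out; this brings [b0] into
    the first and last equations. *)
Lemma commutator_c (x : A) : A01 mul a x ->
  mul x c - mul c x = mul x b0 - mul b0 x.
Proof.
move=> hx; rewrite cE linearDl linearDr linearZl_LR linearZr_LR /=.
by rewrite A01_comm // opprD addrACA subrr add0r.
Qed.

Lemma axis_flexible_components :
  \sum_(p <- s) p.1 *: mul (bS p) (bS p) =
    \sum_(p <- s) p.2 *: mul (bS p) (bS p)
  /\ forall p, p \in s -> p.1 *: mul c (bS p) + (alpha * p.2) *: bS p =
    (alpha * p.1) *: bS p + p.2 *: mul (bS p) c.
Proof.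
have [e0 eS] := flexible_components_A01 a A01_axis bflex.
have [ac ca] := axis_c.
have e1 p : p \in s -> mul a (bS p) = p.1 *: bS p by case/hbS/ApairP.
have e2 p : p \in s -> mul (bS p) a = p.2 *: bS p by case/hbS/ApairP.
split=> [|p ps].
- move: e0; rewrite ac ca linearZr_LR linearZl_LR /= ac ca => /addrI.
  rewrite (eq_big_seq (fun p => p.1 *: mul (bS p) (bS p))); last first.
    by move=> p ps; rewrite e1 // linearZr_LR.
  move=> ->; apply: eq_big_seq => p ps.
  by rewrite e2 // linearZl_LR.
- move: (eS p ps); rewrite ac ca e1 // e2 //.
  by rewrite !linearZr_LR !linearZl_LR /= e1 // e2 // !scalerA.
Qed.

Lemma c_bS (p : F * F) : p \in s ->
  mul c (bS p) = lam p *: bS p /\ mul (bS p) c = rho p *: bS p.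
Proof.
move=> ps; have eps0 := heps p ps.
have cr : mul (bS p) c = bS p - mul c (bS p).
  apply/eqP; rewrite eq_sym subr_eq eq_sym addrC.
  exact/eqP/idempotent_components.
have [_ /(_ p ps) fp] := axis_flexible_components.
have cl : mul c (bS p) = lam p *: bS p.
  (* After multiplication by [p.1 + p.2], the claim is the relation from [z = a] with [mul (bS p) c]
     replaced by [bS p - mul c (bS p)]. *)
  apply: (scalerI eps0); rewrite scalerA /lam mulrC divfK //.
  move: fp; rewrite cr scalerBr => fp.
  rewrite scalerDl -[p.1 *: _](addrK ((alpha * p.2) *: bS p)) fp.
  rewrite addrA [_ - _ - _]addrAC subrK mulrBr scalerDl scalerBl.
  by rewrite [X in X - _ = _]addrC addrA.
split=> //.
rewrite cr cl -{1}[bS p]scale1r -scalerBl.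
by congr (_ *: _); rewrite /lam /rho; field.
Qed.

Lemma b0_bS (p : F * F) : p \in s ->
  mul b0 (bS p) = (lam p - alpha * p.1) *: bS p /\
  mul (bS p) b0 = (rho p - alpha * p.2) *: bS p.
Proof.
move=> ps; have [cl cr] := c_bS p ps; have /ApairP[al ar] := hbS p ps.
rewrite !scalerBl -cl -cr cE linearDl linearDr linearZl_LR linearZr_LR /= al ar.
by rewrite !scalerA ![_ + mul _ _]addrC !addrK.
Qed.

(** The [A01] component for [z = b_p] reads [c v^2 + rho v^2 = v^2 c + lam v^2] with [v = b_p]. *)
Lemma bS_sqr_b0 (p : F * F) : p \in s ->
  ((p.1 - p.2) * ((1 - 2 * alpha) / (p.1 + p.2))) *: mul (bS p) (bS p) =
  mul (mul (bS p) (bS p)) b0 - mul b0 (mul (bS p) (bS p)).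
Proof.
move=> ps; have [cl cr] := c_bS p ps; have eps0 := heps p ps.
rewrite -commutator_c; last exact: Apair_sqr (hbS p ps) (hbS p ps).
have [+ _ _] := flexible_components_Apair p (bS p) ps (hbS p ps) bflex.
rewrite cl cr linearZl_LR linearZr_LR /= => /addr_eq_cross <-.
by rewrite -scalerBl; congr (_ *: _); rewrite /rho /lam; field.
Qed.

Lemma bS_sqr_comm (p q : F * F) : p \in s -> q \in s ->
  mul (bS q) (mul (bS p) (bS p)) = mul (mul (bS p) (bS p)) (bS q).
Proof.
move=> ps qs; have [cl cr] := c_bS p ps.
have [_ e eq_p] := flexible_components_Apair p (bS p) ps (hbS p ps) bflex.
(* For [q] different from [p] this is the [q]-component for [z = b_p]. For [q = p] the [p]-component
   has the extra term [lam rho b_p] on both sides, which cancels. *)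
have [->|qp] := eqVneq q p; last exact: eq_p.
move: e; rewrite cl cr linearZl_LR linearZr_LR /= cl cr !scalerA.
by rewrite [lam p * _]mulrC addrC => /addIr.
Qed.

(** The [p]-component for [z = b_0] gives the scalar [(rho - alpha nu) rho - (lam - alpha mu) lam],
    where [p = (mu, nu)]. *)
Lemma bS_b0_sqr (p : F * F) : p \in s ->
  mul (bS p) (mul b0 b0) - mul (mul b0 b0) (bS p) =
  ((p.1 - p.2) * ((1 - 2 * alpha + alpha ^+ 2 * (p.1 + p.2)) / (p.1 + p.2)))
    *: bS p.
Proof.
move=> ps; have [cl cr] := c_bS p ps; have [bl br] := b0_bS p ps.
have eps0 := heps p ps; have [cb bc] := c_b0.
have [_ /(_ p ps)] := flexible_components_A01 b0 A01_b0 bflex.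
rewrite bl br cb bc linearZl_LR linearZr_LR /= cl cr !scalerA.
rewrite [RHS]addrC => /addr_eq_cross ->; rewrite -scalerBl.
by congr (_ *: _); rewrite /rho /lam; field.
Qed.

Lemma b0_b0_sqr :
  mul b0 (mul b0 b0) - mul (mul b0 b0) b0 =
  (1 - 2 * alpha) *:
    \sum_(p <- s) ((p.1 - p.2) / (p.1 + p.2)) *: mul (bS p) (bS p).
Proof.
have [e _] := axis_flexible_components.
have [cb bc] := c_b0.
have [+ _] := flexible_components_A01 b0 A01_b0 bflex.
rewrite cb bc => /addr_eq_cross.
rewrite commutator_c; last by apply: A01M; exact: A01_b0.
move=> /(congr1 -%R); rewrite !opprB => <-.
rewrite scaler_sumr -sumrB.
(* Each coefficient splits into [rho - lam] and [alpha (mu - nu)]; the second parts sum to zero by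
   the relation [e] obtained from [z = a]. *)
rewrite (eq_big_seq (fun p =>
    (1 - 2 * alpha) *: (((p.1 - p.2) / (p.1 + p.2)) *: mul (bS p) (bS p)) +
    alpha *: (p.1 *: mul (bS p) (bS p) - p.2 *: mul (bS p) (bS p)))); last first.
  move=> p ps; have [-> ->] := b0_bS p ps; have eps0 := heps p ps.
  rewrite linearZl_LR linearZr_LR /= -!scalerBl !scalerA -scalerDl.
  by congr (_ *: _); rewrite /rho /lam; field.
by rewrite big_split /= -!scaler_sumr sumrB e subrr scaler0 addr0.
Qed.

End Flexible.

End Components.
End JointEigenvectors.

(** * Passage to the finite support of [b] *)

Theorem theorem3p8 (F : fieldType) (hchar : 2%N \notin [pchar F])
    (A : lmodType F) (mul : {bilinear A -> A -> A})
    (a b : A)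
    (hgen : gen_subalg mul [set a; b] = [set: A])
    (hdim : dim_ge A 3)
    (ha : is_axis mul a) (hprim : weakly_primitive mul a)
    (hfus : fusion_rules mul a)
    (hb : is_axis mul b)
    (alpha : F) (b0 : A) (bS : F * F -> A)
    (hdec : is_decomp mul a b alpha b0 bS)
    (heps : forall mu nu : F, Scirc mul a (mu, nu) -> mu + nu != 0) :
  forall mu nu : F, Scirc mul a (mu, nu) ->
    let eps := mu + nu in
    let v := bS (mu, nu) in
    [/\ ((mu - nu) * ((1 - 2 * alpha) / eps)) *: mul v v
          = mul (mul v v) b0 - mul b0 (mul v v),
        forall mu' nu' : F, Spair mul a (mu', nu') ->
          mul (bS (mu', nu')) (mul v v) = mul (mul v v) (bS (mu', nu')),
        mul v (mul b0 b0) - mul (mul b0 b0) v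
          = ((mu - nu) * ((1 - 2 * alpha + alpha ^+ 2 * eps) / eps)) *: v
      & mul b0 (mul b0 b0) - mul (mul b0 b0) b0
          = (1 - 2 * alpha) *:
              \sum_(p \in Scirc mul a)
                ((p.1 - p.2) / (p.1 + p.2)) *: mul (bS p) (bS p)].

Proof.
move=> mu nu Cp eps v.
have [haa _ _ _] := ha; have [bb _ _ bcomm] := hb.
have [hb0 hbS hfin bE] := hdec.
set D := Spair mul a `&` [set i | bS i != 0] in hfin.
(* The pair [(mu, nu)] is added because [bS (mu, nu)] may be zero, and [undup] covers the case where
   it is already in the support. Every member of [s] lies in [Scirc], so [heps] applies to it. *)
set s := undup ((mu, nu) :: finmap.enum_fset (fset_set D)).
have us : uniq s by exact: undup_uniq.
have ps : (mu, nu) \in s by rewrite mem_undup mem_head.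
have sC p : p \in s -> Scirc mul a p.
  rewrite mem_undup inE => /orP[/eqP ->//|].
  rewrite in_fset_set // inE => -[Sp /= bSp].
  by split=> //; exists (bS p) => //; exact: hbS.
have sS p : p \in s -> Spair mul a p by case/sC.
have bS0 p : Spair mul a p -> p \notin s -> bS p = 0.
  move=> Sp; rewrite mem_undup inE negb_or => /andP[_].
  rewrite in_fset_set //; apply: contraNeq => bSp; exact/mem_set.
have bSs p : p \in s -> Apair mul a p (bS p) by move=> /sS /hbS.
have epss p : p \in s -> p.1 + p.2 != 0.
  by case: p => p1 p2 /sC /heps.
rewrite (fsbig_seq_supp _ _ _ s) // in bE.
rewrite (fsbig_seq_supp _ _ _ s) //; last first.
  by move=> p [Sp _] /(bS0 p Sp) ->; rewrite linear0l scaler0.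
pose c := alpha *: a + b0.
have hc : A01 mul a c.
  apply: A01D; last exact: A01_b0.
  by apply: A01Z; exact: A01_axis.
split.
- exact: (bS_sqr_b0 F A mul a s us sS hfus b c bS hc bSs bE
    alpha b0 haa hb0 erefl epss bb bcomm (mu, nu) ps).
(* Outside [s] the component of [b] is zero, and so are both sides. *)
- move=> mu' nu' Sq; have [qs|/bS0 ->//] := boolP ((mu', nu') \in s).
    exact: (bS_sqr_comm F A mul a s us sS hfus b c bS hc bSs bE
    alpha b0 haa hb0 erefl epss bb bcomm
      (mu, nu) (mu', nu') ps qs).
  by rewrite linear0l linear0r.
- exact: (bS_b0_sqr F A mul a s us sS hfus b c bS hc bSs bE
    alpha b0 haa hb0 erefl epss bb bcomm (mu, nu) ps).
- exact: (b0_b0_sqr F A mul a s us sS hfus b c bS hc bSs bE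
    alpha b0 haa hb0 erefl epss bb bcomm).
Qed.
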